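(* Let $(M,d)$ be a complete geodesic space such that $(M,d)$ and all its tangent spaces $(T^{(o)}_xM,d_x)$ (for every $x\in M$) are Busemann convex geodesic spaces. If the space $M\times_2\mathbb{R}$ satisfies any one of the properties (SO), (A) or (NE) below, then $(M,d)$ is a $CAT(0)$-space. For a complete geodesic space $(X,\delta)$ these properties are: (SO) for all geodesics $\gamma,\eta:[0,1]\to X$ with $\gamma_0=\eta_0$: $\gamma\perp_{\gamma_0}\eta$ iff $\eta\perp_{\gamma_0}\gamma$; (A) whenever $\gamma$ is a geodesic and $x\in X$, then for all $t\in[0,1]$ and $x_C\in\pi_\gamma(x)$: $\delta(x_C,\gamma_t)\le\delta(x,\gamma_t)$; (NE) whenever $C\subset X$ is closed and convex and $x,y\in X$, then for all $x_C\in\pi_C(x)$, $y_C\in\pi_C(y)$: $\delta(x_C,y_C)\le\delta(x,y)$.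
   Context: Geodesics are maps $\gamma:[0,1]\to X$ with $\delta(\gamma_t,\gamma_s)=|t-s|\delta(\gamma_0,\gamma_1)$. A geodesic space is Busemann convex if for all geodesics $\gamma,\eta$ with $\gamma_0=\eta_0$, $\delta(\gamma_{1/2},\eta_{1/2})\le\frac12\delta(\gamma_1,\eta_1)$. For geodesics with $p=\gamma_0=\eta_0$, $\gamma\perp_p\eta$ means $\delta(p,\gamma_t)\le\delta(\eta_s,\gamma_t)$ for all $s,t\in[0,1]$. $\pi_C(x)$ is the set of points of $C$ at minimal distance from $x$; $\pi_\gamma=\pi_{\gamma([0,1])}$. A set is convex if all geodesics between its points lie in it. $M\times_2\mathbb{R}$ is $M\times\mathbb{R}$ with metric $\tilde d((x,t),(y,s))^2=d(x,y)^2+|t-s|^2$. Tangent space: fix a sequence $\lambda_n>0$, $\lambda_n\to0$, and a non-principal ultrafilter $\omega$ on $\mathbb{N}$; $(T^{(o)}_xM,d_x)$ is the ultralimit of the pointed spaces $(M,\lambda_n^{-1}d,x)$, i.e. the set of sequences $(x_n)$ in $M$ with $\lim_\omega\lambda_n^{-1}d(x_n,x)<\infty$, modulo $\lim_\omega\lambda_n^{-1}d(x_n,y_n)=0$, with metric $d_x((x_n),(y_n))=\lim_\omega\lambda_n^{-1}d(x_n,y_n)$ (the hypothesis is for all such choices). $(M,d)$ is $CAT(0)$ if for all $x,y,z\in M$ and a Euclidean comparison triangle $\tilde x,\tilde y,\tilde z\in\mathbb{R}^2$ with the same side lengths, $d(x,m)\le\|\tilde x-\tilde m\|$, where $m,\tilde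 m$ are midpoints of $y,z$ resp. $\tilde y,\tilde z$. *)

(* Defs.v *)
From Stdlib Require Import Reals Lra ClassicalEpsilon.
Open Scope R_scope.

Set Implicit Arguments.

Definition is_metric {X : Type} (dist : X -> X -> R) : Prop :=
  (forall x y, 0 <= dist x y) /\
  (forall x y, dist x y = 0 <-> x = y) /\
  (forall x y, dist x y = dist y x) /\
  (forall x y z, dist x z <= dist x y + dist y z).

Definition cauchy_seq {X : Type} (dist : X -> X -> R) (u : nat -> X) : Prop :=
  forall eps, 0 < eps -> exists N, forall m n, (N <= m)%nat -> (N <= n)%nat ->
    dist (u m) (u n) < eps.

Definition complete {X : Type} (dist : X -> X -> R) : Prop :=
  forall u : nat -> X, cauchy_seq dist u ->
    exists l, forall eps, 0 < eps -> exists N, forall n, (N <= n)%nat ->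
      dist (u n) l < eps.

Definition unit_I (t : R) : Prop := 0 <= t <= 1.

(** geodesic gamma : [0,1] -> X (values outside [0,1] are irrelevant) *)
Definition is_geodesic {X : Type} (dist : X -> X -> R) (g : R -> X) : Prop :=
  forall t s, unit_I t -> unit_I s ->
    dist (g t) (g s) = Rabs (t - s) * dist (g 0) (g 1).

Definition geodesic_space {X : Type} (dist : X -> X -> R) : Prop :=
  forall x y, exists g, is_geodesic dist g /\ g 0 = x /\ g 1 = y.

Definition busemann_convex {X : Type} (dist : X -> X -> R) : Prop :=
  forall g h, is_geodesic dist g -> is_geodesic dist h -> g 0 = h 0 ->
    dist (g (1/2)) (h (1/2)) <= 1/2 * dist (g 1) (h 1).

(** Versions for a pseudo-metric space, i.e. the metric quotient is meant:
    points at distance 0 are identified. *)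
Definition pgeodesic_space {X : Type} (dist : X -> X -> R) : Prop :=
  forall x y, exists g, is_geodesic dist g /\ dist (g 0) x = 0 /\ dist (g 1) y = 0.

Definition pbusemann_convex {X : Type} (dist : X -> X -> R) : Prop :=
  forall g h, is_geodesic dist g -> is_geodesic dist h -> dist (g 0) (h 0) = 0 ->
    dist (g (1/2)) (h (1/2)) <= 1/2 * dist (g 1) (h 1).

(** orthogonality gamma ⊥_p eta, for p = gamma_0 = eta_0 *)
Definition perp {X : Type} (dist : X -> X -> R) (p : X) (g h : R -> X) : Prop :=
  forall s t, unit_I s -> unit_I t -> dist p (g t) <= dist (h s) (g t).

Definition proj {X : Type} (dist : X -> X -> R) (C : X -> Prop) (x xC : X) : Prop :=
  C xC /\ forall c, C c -> dist x xC <= dist x c.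

Definition geodesic_image {X : Type} (g : R -> X) : X -> Prop :=
  fun y => exists t, unit_I t /\ y = g t.

Definition convex_set {X : Type} (dist : X -> X -> R) (C : X -> Prop) : Prop :=
  forall g, is_geodesic dist g -> C (g 0) -> C (g 1) ->
    forall t, unit_I t -> C (g t).

Definition closed_set {X : Type} (dist : X -> X -> R) (C : X -> Prop) : Prop :=
  forall x, (forall eps, 0 < eps -> exists c, C c /\ dist x c < eps) -> C x.

Definition prop_SO {X : Type} (dist : X -> X -> R) : Prop :=
  forall g h, is_geodesic dist g -> is_geodesic dist h -> g 0 = h 0 ->
    (perp dist (g 0) g h <-> perp dist (g 0) h g).

Definition prop_A {X : Type} (dist : X -> X -> R) : Prop :=
  forall g x, is_geodesic dist g ->
    forall t xC, unit_I t -> proj dist (geodesic_image g) x xC ->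
      dist xC (g t) <= dist x (g t).

Definition prop_NE {X : Type} (dist : X -> X -> R) : Prop :=
  forall C, closed_set dist C -> convex_set dist C ->
    forall x y xC yC, proj dist C x xC -> proj dist C y yC ->
      dist xC yC <= dist x y.

Definition l2_prod_dist {M : Type} (d : M -> M -> R) (p q : M * R) : R :=
  sqrt (d (fst p) (fst q) ^ 2 + (snd p - snd q) ^ 2).

Definition eucl (p q : R * R) : R :=
  sqrt ((fst p - fst q) ^ 2 + (snd p - snd q) ^ 2).

Definition is_midpoint {X : Type} (dist : X -> X -> R) (y z m : X) : Prop :=
  dist y m = dist y z / 2 /\ dist m z = dist y z / 2.

Definition CAT0 {X : Type} (dist : X -> X -> R) : Prop :=
  forall x y z m (xt yt zt : R * R),
    eucl xt yt = dist x y -> eucl yt zt = dist y z -> eucl xt zt = dist x z ->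
    is_midpoint dist y z m ->
    dist x m <= eucl xt ((fst yt + fst zt) / 2, (snd yt + snd zt) / 2).

Definition nonprincipal_ultrafilter (U : (nat -> Prop) -> Prop) : Prop :=
  U (fun _ => True) /\
  ~ U (fun _ => False) /\
  (forall A B : nat -> Prop, (forall n, A n -> B n) -> U A -> U B) /\
  (forall A B : nat -> Prop, U A -> U B -> U (fun n => A n /\ B n)) /\
  (forall A : nat -> Prop, U A \/ U (fun n => ~ A n)) /\
  (forall k, ~ U (fun n => n = k)).

Definition is_ulim (U : (nat -> Prop) -> Prop) (a : nat -> R) (L : R) : Prop :=
  forall eps, 0 < eps -> U (fun n => Rabs (a n - L) < eps).

(** lim_omega a (the omega-limit; it exists and is unique for omega-bounded a) *)
Definition ulim (U : (nat -> Prop) -> Prop) (a : nat -> R) : R :=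
  epsilon (inhabits 0) (is_ulim U a).

(** Tangent space T^(o)_x M: sequences (x_n) with lim_omega lam_n^-1 d(x_n,x) < oo,
    with pseudo-metric d_x; the metric quotient is the tangent space. *)
Definition tangent_pt {M : Type} (d : M -> M -> R) (lam : nat -> R)
  (U : (nat -> Prop) -> Prop) (x : M) : Type :=
  { u : nat -> M | exists B, U (fun n => d (u n) x / lam n <= B) }.

Definition tangent_dist {M : Type} (d : M -> M -> R) (lam : nat -> R)
  (U : (nat -> Prop) -> Prop) (x : M) (u v : tangent_pt d lam U x) : R :=
  ulim U (fun n => d (proj1_sig u n) (proj1_sig v n) / lam n).
Arguments tangent_dist {M} d lam U x u v.

(* Main.v *)
(** Write [f t = d(x, gamma_t)] for a geodesic [gamma] of length [l]. Each of the three
    properties makes orthogonality in [M x R] symmetric, and tilting the two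
    geodesics vertically turns this into the symmetry of the first variation:
    the initial slope of [d(g_1, .)] along [h] and that of [d(h_1, .)] along [g]
    encode the same angle. Let [P], [R], [Q] be consecutive points on [gamma], and let
    [R_e], [Q_e] be the points at fraction [e] of the geodesics from [R], [Q] to [x].
    Then [d(P, Q_e) <= d(P, R_e) + d(R_e, Q_e) <= d(P, R_e) + (1 - e) d(R, Q)],
    and comparing first orders in [e] shows that the left derivative of
    [f^2 - l^2 t^2] is nondecreasing. So this function is convex, which at [t = 1/2]
    is the CAT(0) inequality. *)

Require Import Defs.
From Stdlib Require Import Reals Lra Classical.
Open Scope R_scope.

Set Implicit Arguments.

(** * Metric preliminaries and minima of Lipschitz functions *)

Lemma dist_refl (X : Type) (d : X -> X -> R) (x : X) : is_metric d -> d x x = 0.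
Proof. intros (_ & H & _). now apply H. Qed.

Lemma Rabs_le_bounds (a b : R) : Rabs a <= b -> - b <= a <= b.
Proof. unfold Rabs. destruct Rcase_abs; lra. Qed.

(** Precomposing with the clamp onto [[a, b]] gives a function continuous on all of R that agrees
    with [f] on the interval, so the extreme value theorem applies at the endpoints too. *)
Lemma lipschitz_attains_min (f : R -> R) (a b K : R) :
  a <= b ->
  (forall s t, a <= s <= b -> a <= t <= b -> Rabs (f s - f t) <= K * Rabs (s - t)) ->
  exists m, a <= m <= b /\ forall t, a <= t <= b -> f m <= f t.
Proof.
intros Hab Hf.
set (c := fun t => Rmax a (Rmin b t)).
assert (Hc : forall t, a <= c t <= b).
{ intros t. unfold c, Rmax, Rmin. repeat destruct Rle_dec; lra. }
assert (Hcid : forall t, a <= t <= b -> c t = t).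
{ intros t Ht. unfold c, Rmax, Rmin. repeat destruct Rle_dec; lra. }
assert (Hcl : forall s t, Rabs (c s - c t) <= Rabs (s - t)).
{ intros s t. unfold c, Rmax, Rmin.
  repeat destruct Rle_dec; unfold Rabs; repeat destruct Rcase_abs; lra. }
destruct (continuity_ab_min (fun t => f (c t)) a b Hab) as [m [Hm Hm']].
- intros t Ht eps Heps.
  pose proof (Rabs_pos K) as HK.
  exists (eps / (Rabs K + 1)). split.
  { apply Rdiv_lt_0_compat; lra. }
  intros s [_ Hs]. unfold Rdist in *. simpl in *. unfold Rdist in *.
  apply Rle_lt_trans with (K * Rabs (c s - c t)); [now apply Hf|].
  apply Rle_lt_trans with ((Rabs K + 1) * Rabs (s - t)).
  + pose proof (Hcl s t). pose proof (Rle_abs K).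
    pose proof (Rabs_pos (c s - c t)). nra.
  + apply Rmult_lt_reg_r with (/ (Rabs K + 1)).
    { apply Rinv_0_lt_compat; lra. }
    replace ((Rabs K + 1) * Rabs (s - t) * / (Rabs K + 1)) with (Rabs (s - t))
      by (field; lra). exact Hs.
- exists m. split; [exact Hm'|]. intros t Ht.
  specialize (Hm t Ht). rewrite !Hcid in Hm; auto.
Qed.

(** * Reparametrizing and concatenating geodesics *)

Lemma geodesic_sub (X : Type) (d : X -> X -> R) (g : R -> X) (u v : R) :
  is_geodesic d g -> unit_I u -> unit_I v ->
  is_geodesic d (fun t => g (u + t * (v - u))).
Proof.
unfold is_geodesic, unit_I. intros Hg Hu Hv t s Ht Hs.
assert (H : forall w, 0 <= w <= 1 -> 0 <= u + w * (v - u) <= 1) by (intros; nra).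
rewrite Hg by (apply H; lra).
rewrite (Hg (u + 0 * (v - u)) (u + 1 * (v - u))) by (apply H; lra).
rewrite <- Rmult_assoc, <- Rabs_mult. f_equal.
rewrite <- Rabs_Ropp. f_equal. ring.
Qed.

Lemma geodesic_rev (X : Type) (d : X -> X -> R) (g : R -> X) :
  is_geodesic d g -> is_geodesic d (fun t => g (1 - t)).
Proof.
intros Hg t s Ht Hs. unfold unit_I in *.
rewrite Hg by (unfold unit_I; lra).
rewrite (Hg (1 - 0) (1 - 1)) by (unfold unit_I; lra).
replace (1 - t - (1 - s)) with (-(t - s)) by ring.
rewrite Rabs_Ropp. replace (1 - 0 - (1 - 1)) with 1 by ring. rewrite Rabs_R1. ring.
Qed.

Lemma geodesic_start (X : Type) (d : X -> X -> R) (g : R -> X) (t : R) :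
  is_geodesic d g -> unit_I t -> d (g 0) (g t) = t * d (g 0) (g 1).
Proof.
intros Hg Ht. rewrite Hg; [|unfold unit_I; lra|assumption].
rewrite Rabs_left1 by (unfold unit_I in *; lra). ring.
Qed.

Lemma geodesic_end (X : Type) (d : X -> X -> R) (g : R -> X) (t : R) :
  is_geodesic d g -> unit_I t -> d (g t) (g 1) = (1 - t) * d (g 0) (g 1).
Proof.
intros Hg Ht. rewrite Hg; [|assumption|unfold unit_I; lra].
rewrite Rabs_left1 by (unfold unit_I in *; lra). ring.
Qed.

Lemma geodesic_through (X : Type) (d : X -> X -> R) (x y z : X) (t : R) :
  is_metric d -> geodesic_space d -> 0 < t < 1 ->
  d x y = t * d x z -> d y z = (1 - t) * d x z ->
  exists g, is_geodesic d g /\ g 0 = x /\ g 1 = z /\ g t = y.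
Proof.
intros Hd Hgs Ht Hxy Hyz.
pose proof Hd as (Hpos & Hsep & Hsym & Htri).
destruct (Hgs x y) as [g [Hg [Hg0 Hg1]]].
destruct (Hgs y z) as [h [Hh [Hh0 Hh1]]].
set (k := fun s => if Rle_dec s t then g (s / t) else h ((s - t) / (1 - t))).
assert (Hk : forall s r, 0 <= s <= r -> r <= 1 -> d (k s) (k r) = (r - s) * d x z).
{ assert (HA : forall s, 0 <= s <= t -> unit_I (s / t)).
  { intros s Hs. split.
    - apply Rmult_le_pos; [lra|]. left. apply Rinv_0_lt_compat. lra.
    - apply Rmult_le_reg_r with t; [lra|]. unfold Rdiv.
      rewrite Rmult_assoc, Rinv_l; lra. }
  assert (HB : forall s, t <= s <= 1 -> unit_I ((s - t) / (1 - t))).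
  { intros s Hs. split.
    - apply Rmult_le_pos; [lra|]. left. apply Rinv_0_lt_compat. lra.
    - apply Rmult_le_reg_r with (1 - t); [lra|]. unfold Rdiv.
      rewrite Rmult_assoc, Rinv_l; lra. }
  (* The upper bound suffices: if [k] shortened the piece from [s] to [r], the triangle inequality
     over the three pieces would make [d x z] smaller than itself. *)
  assert (Hle : forall s r, 0 <= s <= r -> r <= 1 -> d (k s) (k r) <= (r - s) * d x z).
  { assert (H1 : forall s r, 0 <= s <= r -> r <= t -> d (g (s / t)) (g (r / t)) = (r - s) * d x z).
    { intros s r Hs Hr. rewrite Hg by (apply HA; lra).
      replace (s / t - r / t) with ((s - r) * / t) by (field; lra).
      rewrite Rabs_mult, Rabs_left1, Rabs_inv, (Rabs_right t), Hg0, Hg1, Hxy by lra.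
      field. lra. }
    assert (H2 : forall s r, t <= s <= r -> r <= 1 ->
       d (h ((s - t) / (1 - t))) (h ((r - t) / (1 - t))) = (r - s) * d x z).
    { intros s r Hs Hr. rewrite Hh by (apply HB; lra).
      replace ((s - t) / (1 - t) - (r - t) / (1 - t)) with ((s - r) * / (1 - t)) by (field; lra).
      rewrite Rabs_mult, Rabs_left1, Rabs_inv, (Rabs_right (1 - t)), Hh0, Hh1, Hyz by lra.
      field. lra. }
    intros s r Hs Hr. unfold k.
    destruct (Rle_dec s t); destruct (Rle_dec r t).
    - rewrite H1; lra.
    - assert (Hm : g (t / t) = h ((t - t) / (1 - t))).
      { replace (t / t) with 1 by (field; lra).
        replace ((t - t) / (1 - t)) with 0 by (field; lra). congruence. }
      eapply Rle_trans; [apply (Htri _ (g (t / t)))|].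
      rewrite H1 by lra. rewrite Hm, H2 by lra. lra.
    - lra.
    - rewrite H2; lra. }
  assert (Hk0 : k 0 = x).
  { unfold k. destruct Rle_dec; [|lra]. now replace (0 / t) with 0 by (field; lra). }
  assert (Hk1 : k 1 = z).
  { unfold k. destruct Rle_dec; [lra|].
    now replace ((1 - t) / (1 - t)) with 1 by (field; lra). }
  intros s r Hs Hr.
  pose proof (Hle s r Hs Hr). pose proof (Hle 0 s ltac:(lra) ltac:(lra)) as H0.
  pose proof (Hle r 1 ltac:(lra) ltac:(lra)) as H1.
  rewrite Hk0 in H0. rewrite Hk1 in H1.
  pose proof (Htri x (k s) z). pose proof (Htri (k s) (k r) z). lra. }
assert (Hk0 : k 0 = x).
{ unfold k. destruct Rle_dec; [|lra]. now replace (0 / t) with 0 by (field; lra). }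
assert (Hk1 : k 1 = z).
{ unfold k. destruct Rle_dec; [lra|].
  now replace ((1 - t) / (1 - t)) with 1 by (field; lra). }
exists k. repeat split; auto.
- intros s r Hs Hr. unfold unit_I in *. rewrite Hk0, Hk1.
  destruct (Rle_dec s r).
  + rewrite Hk, Rabs_left1 by lra. ring.
  + rewrite Hsym, Hk, Rabs_right by lra. ring.
- unfold k. destruct Rle_dec; [|lra]. now replace (t / t) with 1 by (field; lra).
Qed.

(** * Convexity of distances under Busemann convexity *)

Lemma dist_diff_le (X : Type) (d : X -> X -> R) (x y z w : X) :
  is_metric d -> Rabs (d x y - d z w) <= d x z + d y w.
Proof.
intros (Hpos & Hsep & Hsym & Htri). apply Rabs_le.
pose proof (Htri x z y). pose proof (Htri z w y). pose proof (Htri z x w).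
pose proof (Htri x y w). rewrite (Hsym w y), (Hsym z x) in *. lra.
Qed.

(** Draw the diagonal from [g 0] to [h 1] and apply Busemann convexity to the two triangles it cuts
    off, in the second one with reversed geodesics. *)
Lemma busemann_midpoint (X : Type) (d : X -> X -> R) (g h : R -> X) :
  is_metric d -> geodesic_space d -> busemann_convex d ->
  is_geodesic d g -> is_geodesic d h ->
  d (g (1/2)) (h (1/2)) <= (d (g 0) (h 0) + d (g 1) (h 1)) / 2.
Proof.
intros Hd Hgs Hb Hg Hh. pose proof Hd as (Hpos & Hsep & Hsym & Htri).
destruct (Hgs (g 0) (h 1)) as [k [Hk [Hk0 Hk1]]].
pose proof (Hb g k Hg Hk (eq_sym Hk0)) as H1.
pose proof (Hb _ _ (geodesic_rev Hk) (geodesic_rev Hh)) as H2. cbv beta in H2.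
replace (1 - 0) with 1 in H2 by ring. replace (1 - 1) with 0 in H2 by ring.
replace (1 - 1/2) with (1/2) in H2 by field.
specialize (H2 Hk1). rewrite Hk0 in H2. rewrite Hk1 in H1.
pose proof (Htri (g (1/2)) (k (1/2)) (h (1/2))). lra.
Qed.

(** The defect [f] is midpoint concave and vanishes at 0 and 1. Its minimum point [m] is the
    midpoint of the nearer endpoint and another point of the interval, so [f m] is at least half of
    itself, hence nonnegative. *)
Lemma busemann_cone (X : Type) (d : X -> X -> R) (g h : R -> X) (t : R) :
  is_metric d -> geodesic_space d -> busemann_convex d ->
  is_geodesic d g -> is_geodesic d h -> g 0 = h 0 -> unit_I t ->
  d (g t) (h t) <= t * d (g 1) (h 1).
Proof.
intros Hd Hgs Hb Hg Hh H0 Ht. pose proof Hd as (Hpos & Hsep & Hsym & Htri).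
set (f := fun t => t * d (g 1) (h 1) - d (g t) (h t)).
assert (Hmid : forall s r, unit_I s -> unit_I r -> f ((s + r) / 2) >= (f s + f r) / 2).
{ intros s r Hs Hr. unfold f.
  pose proof (busemann_midpoint Hd Hgs Hb (geodesic_sub Hg Hs Hr) (geodesic_sub Hh Hs Hr)) as H.
  cbv beta in H. replace (s + 1/2 * (r - s)) with ((s + r) / 2) in H by field.
  replace (s + 0 * (r - s)) with s in H by ring.
  replace (s + 1 * (r - s)) with r in H by ring. lra. }
assert (f0 : f 0 = 0). { unfold f. rewrite H0, (dist_refl _ Hd). ring. }
assert (f1 : f 1 = 0). { unfold f. ring. }
destruct (@lipschitz_attains_min f 0 1
  (d (g 1) (h 1) + (d (g 0) (g 1) + d (h 0) (h 1)))) as [m [Hm Hmin]]; [lra| |].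
- intros s r Hs Hr. unfold f.
  replace (s * d (g 1) (h 1) - d (g s) (h s) - (r * d (g 1) (h 1) - d (g r) (h r)))
    with ((s - r) * d (g 1) (h 1) + - (d (g s) (h s) - d (g r) (h r))) by ring.
  eapply Rle_trans; [apply Rabs_triang|].
  rewrite Rabs_mult, (Rabs_right (d (g 1) (h 1))), Rabs_Ropp by (apply Rle_ge, Hpos).
  pose proof (dist_diff_le (g s) (h s) (g r) (h r) Hd).
  rewrite Hg, Hh in H by assumption. lra.
- enough (0 <= f m). { specialize (Hmin t Ht). unfold f in *. lra. }
  destruct (Rle_dec m (1/2)).
  + pose proof (Hmid 0 (2 * m) ltac:(unfold unit_I; lra) ltac:(unfold unit_I; lra)) as H.
    replace ((0 + 2 * m) / 2) with m in H by field.
    pose proof (Hmin (2 * m) ltac:(lra)). lra.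
  + pose proof (Hmid (2 * m - 1) 1 ltac:(unfold unit_I; lra) ltac:(unfold unit_I; lra)) as H.
    replace ((2 * m - 1 + 1) / 2) with m in H by field.
    pose proof (Hmin (2 * m - 1) ltac:(lra)). lra.
Qed.

(** Go from [x] to [g t] through the point at fraction [t] of the geodesic from [g 0] to [x]; the
    second leg is bounded by [busemann_cone]. *)
Lemma busemann_point (X : Type) (d : X -> X -> R) (x : X) (g : R -> X) (t : R) :
  is_metric d -> geodesic_space d -> busemann_convex d ->
  is_geodesic d g -> unit_I t ->
  d x (g t) <= (1 - t) * d x (g 0) + t * d x (g 1).
Proof.
intros Hd Hgs Hb Hg Ht. pose proof Hd as (Hpos & Hsep & Hsym & Htri).
destruct (Hgs (g 0) x) as [k [Hk [Hk0 Hk1]]].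
pose proof (busemann_cone Hd Hgs Hb Hk Hg Hk0 Ht) as H1.
pose proof (geodesic_end Hk Ht) as H2.
rewrite Hk0 in H2. rewrite Hk1 in H1, H2.
pose proof (Htri x (k t) (g t)). rewrite (Hsym x (k t)), H2 in H.
rewrite (Hsym x (g 0)). lra.
Qed.

(** The concatenation through [y] is a geodesic with the same endpoints as [g], and [busemann_cone]
    forces the two to coincide. *)
Lemma busemann_unique (X : Type) (d : X -> X -> R) (g : R -> X) (y : X) (t : R) :
  is_metric d -> geodesic_space d -> busemann_convex d ->
  is_geodesic d g -> unit_I t ->
  d (g 0) y = t * d (g 0) (g 1) -> d y (g 1) = (1 - t) * d (g 0) (g 1) -> y = g t.
Proof.
intros Hd Hgs Hb Hg Ht H0 H1. pose proof Hd as (Hpos & Hsep & Hsym & Htri).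
destruct (Req_dec t 0) as [->|Ht0].
{ symmetry. apply Hsep. lra. }
destruct (Req_dec t 1) as [->|Ht1].
{ apply Hsep. lra. }
unfold unit_I in Ht.
destruct (@geodesic_through X d (g 0) y (g 1) t Hd Hgs ltac:(lra) H0 H1) as [k [Hk [Hk0 [Hk1 Hkt]]]].
rewrite <- Hkt. apply Hsep.
pose proof (busemann_cone Hd Hgs Hb Hk Hg Hk0 Ht) as H2.
rewrite Hk1, (dist_refl _ Hd), Rmult_0_r in H2. pose proof (Hpos (k t) (g t)). lra.
Qed.

(** * The product of M with the line *)

Lemma l2_prod_sqr (M : Type) (d : M -> M -> R) (p q : M * R) :
  l2_prod_dist d p q ^ 2 = d (fst p) (fst q) ^ 2 + (snd p - snd q) ^ 2.
Proof. unfold l2_prod_dist. rewrite pow2_sqrt; [reflexivity|].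
apply Rplus_le_le_0_compat; apply pow2_ge_0.
Qed.

Lemma l2_prod_metric (M : Type) (d : M -> M -> R) :
  is_metric d -> is_metric (l2_prod_dist d).
Proof.
intros Hd. pose proof Hd as (Hpos & Hsep & Hsym & Htri).
assert (Hp : forall x y, 0 <= l2_prod_dist d x y) by (intros; apply sqrt_pos).
split; [exact Hp|split; [|split]].
- intros x y. split.
  + intros H. pose proof (l2_prod_sqr d x y) as H2. rewrite H in H2.
    pose proof (pow2_ge_0 (d (fst x) (fst y))). pose proof (pow2_ge_0 (snd x - snd y)).
    assert (d (fst x) (fst y) = 0) by (apply Rsqr_0_uniq; unfold Rsqr; lra).
    assert (snd x - snd y = 0) by (apply Rsqr_0_uniq; unfold Rsqr; lra).
    destruct x as [x1 x2], y as [y1 y2]; simpl in *. f_equal; [now apply Hsep|lra].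
  + intros ->. unfold l2_prod_dist. rewrite (dist_refl _ Hd).
    replace (0 ^ 2 + (snd y - snd y) ^ 2) with 0 by ring. apply sqrt_0.
- intros x y. unfold l2_prod_dist. rewrite Hsym. f_equal. ring.
- intros x y z.
  pose proof (l2_prod_sqr d x y) as H1. pose proof (l2_prod_sqr d y z) as H2.
  pose proof (l2_prod_sqr d x z) as H3.
  pose proof (Hp x y) as P1. pose proof (Hp y z) as P2. pose proof (Hp x z) as P3.
  set (u := l2_prod_dist d x y) in *. set (v := l2_prod_dist d y z) in *.
  set (w := l2_prod_dist d x z) in *.
  pose proof (Htri (fst x) (fst y) (fst z)) as T.
  pose proof (Hpos (fst x) (fst y)). pose proof (Hpos (fst y) (fst z)).
  pose proof (Hpos (fst x) (fst z)).
  set (a := d (fst x) (fst y)) in *. set (b := d (fst y) (fst z)) in *.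
  set (c := d (fst x) (fst z)) in *.
  set (e := snd x - snd y) in *. set (f := snd y - snd z) in *.
  replace (snd x - snd z) with (e + f) in H3 by (unfold e, f; ring).
  assert (CS : a * b + e * f <= u * v).
  { apply Rsqr_incr_0_var; [|nra]. unfold Rsqr.
    replace (u * v * (u * v)) with (u ^ 2 * v ^ 2) by ring. rewrite H1, H2.
    pose proof (pow2_ge_0 (a * f - e * b)). nra. }
  apply Rsqr_incr_0_var; [unfold Rsqr|lra].
  assert (c * c <= (a + b) * (a + b)) by nra. nra.
Qed.

Lemma l2_prod_geodesic (M : Type) (d : M -> M -> R) (g : R -> M) (c : R) :
  is_metric d -> is_geodesic d g -> is_geodesic (l2_prod_dist d) (fun t => (g t, c * t)).
Proof.
intros (Hpos & _) Hg t s Ht Hs. unfold l2_prod_dist; simpl fst; simpl snd.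
rewrite Hg by assumption.
rewrite Rpow_mult_distr, pow2_abs.
rewrite <- sqrt_Rsqr_abs, <- sqrt_mult_alt by apply Rle_0_sqr. f_equal.
unfold Rsqr. ring.
Qed.

(** This is the equality case of Minkowski's inequality: the planar vectors [(a, e)] and [(b, f)]
    must be proportional, and [c] must equal [a + b]. *)
Lemma l2_prod_between (M : Type) (d : M -> M -> R) (x y z : M * R) (t : R) :
  is_metric d -> unit_I t ->
  l2_prod_dist d x y = t * l2_prod_dist d x z ->
  l2_prod_dist d y z = (1 - t) * l2_prod_dist d x z ->
  d (fst x) (fst y) = t * d (fst x) (fst z) /\
  d (fst y) (fst z) = (1 - t) * d (fst x) (fst z) /\
  snd y = snd x + t * (snd z - snd x).
Proof.
intros Hd Ht Hxy Hyz. pose proof Hd as (Hpos & Hsep & Hsym & Htri). unfold unit_I in Ht.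
pose proof (l2_prod_sqr d x y) as H1. pose proof (l2_prod_sqr d y z) as H2.
pose proof (l2_prod_sqr d x z) as H3.
pose proof (proj1 (l2_prod_metric Hd) x z) as P.
rewrite Hxy in H1. rewrite Hyz in H2. clear Hxy Hyz.
set (D := l2_prod_dist d x z) in *.
pose proof (Htri (fst x) (fst y) (fst z)) as T.
pose proof (Hpos (fst x) (fst y)). pose proof (Hpos (fst y) (fst z)).
pose proof (Hpos (fst x) (fst z)).
set (a := d (fst x) (fst y)) in *. set (b := d (fst y) (fst z)) in *.
set (c := d (fst x) (fst z)) in *.
set (e := snd y - snd x) in *. set (f := snd z - snd y) in *.
replace (snd x - snd y) with (- e) in H1 by (unfold e; ring).
replace (snd y - snd z) with (- f) in H2 by (unfold f; ring).
replace (snd x - snd z) with (- (e + f)) in H3 by (unfold e, f; ring).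
assert (Hc : c ^ 2 <= (a + b) ^ 2) by nra.
(* Expand [D ^ 2 = c ^ 2 + (e + f) ^ 2], bound [c] by [a + b], and use that the two vectors have
   squared lengths [t ^ 2 * D ^ 2] and [(1 - t) ^ 2 * D ^ 2]. *)
assert (Hab : t * (1 - t) * D ^ 2 <= a * b + e * f) by nra.
assert (Htt : 0 <= t * (1 - t)) by nra.
assert (Hz : ((1 - t) * a - t * b) ^ 2 + ((1 - t) * e - t * f) ^ 2 <= 0).
{ replace (((1 - t) * a - t * b) ^ 2 + ((1 - t) * e - t * f) ^ 2) with
    ((1 - t) ^ 2 * (a ^ 2 + (- e) ^ 2) + t ^ 2 * (b ^ 2 + (- f) ^ 2)
      - 2 * (t * (1 - t)) * (a * b + e * f)) by ring.
  rewrite <- H1, <- H2.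
  pose proof (Rmult_le_compat_l _ _ _ Htt Hab). nra. }
pose proof (pow2_ge_0 ((1 - t) * a - t * b)). pose proof (pow2_ge_0 ((1 - t) * e - t * f)).
assert (Ha : (1 - t) * a - t * b = 0) by (apply Rsqr_0_uniq; unfold Rsqr; lra).
assert (He : (1 - t) * e - t * f = 0) by (apply Rsqr_0_uniq; unfold Rsqr; lra).
assert (Hae : a = t * (a + b)) by lra.
assert (Hbe : b = (1 - t) * (a + b)) by lra.
assert (Hee : e = t * (e + f)) by lra.
assert (Hfe : f = (1 - t) * (e + f)) by lra.
assert (Hs : (a + b) ^ 2 <= c ^ 2).
{ assert (Hsum : (a + b) ^ 2 + (e + f) ^ 2 = D ^ 2).
  { set (S := a + b) in *. set (G := e + f) in *.
    destruct (Req_dec t 0) as [Et|Et].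
    - rewrite Hbe, Hfe, Et in H2. nra.
    - rewrite Hae, Hee in H1.
      apply Rmult_eq_reg_l with (t ^ 2); [nra|]. apply pow_nonzero; assumption. }
  nra. }
assert (Hcs : a + b = c) by nra.
rewrite Hcs in Hae, Hbe. repeat split; try assumption.
replace (snd z - snd x) with (e + f) by (unfold e, f; ring).
rewrite <- Hee. unfold e. ring.
Qed.

(** * Geodesic images as closed convex sets, and symmetry of orthogonality *)

Lemma geodesic_image_closed (X : Type) (d : X -> X -> R) (g : R -> X) :
  is_metric d -> is_geodesic d g -> Defs.closed_set d (geodesic_image g).
Proof.
intros Hd Hg x Hx. pose proof Hd as (Hpos & Hsep & Hsym & Htri).
destruct (@lipschitz_attains_min (fun t => d x (g t)) 0 1 (d (g 0) (g 1)))
  as [m [Hm Hmin]]; [lra| |].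
- intros s t Hs Ht. pose proof (dist_diff_le x (g s) x (g t) Hd) as H.
  rewrite (dist_refl _ Hd), Hg in H by assumption. lra.
- exists m. split; [assumption|]. apply Hsep.
  destruct (Rle_lt_or_eq_dec _ _ (Hpos x (g m))) as [Hlt|]; [exfalso|congruence].
  destruct (Hx _ Hlt) as [c [[t [Ht ->]] Hc]]. specialize (Hmin t Ht). lra.
Qed.

(** A geodesic of the product projects to intermediate points in M, which uniqueness of geodesics
    places on [h] at the parameter dictated by the height. *)
Lemma l2_prod_geodesic_image_convex (M : Type) (d : M -> M -> R) (h : R -> M) (c : R) :
  is_metric d -> geodesic_space d -> busemann_convex d -> is_geodesic d h ->
  convex_set (l2_prod_dist d) (geodesic_image (fun t => (h t, c * t))).
Proof.
intros Hd Hgs Hb Hh k Hk [a [Ha Hk0]] [b [Hbb Hk1]] t Ht.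
destruct (l2_prod_between _ _ _ Hd Ht (geodesic_start Hk Ht) (geodesic_end Hk Ht))
  as [H1 [H2 H3]].
rewrite Hk0, Hk1 in H1, H2, H3. simpl in H1, H2, H3.
pose proof (busemann_unique (fst (k t)) Hd Hgs Hb (geodesic_sub Hh Ha Hbb) Ht) as H.
cbv beta in H.
replace (a + 0 * (b - a)) with a in H by ring.
replace (a + 1 * (b - a)) with b in H by ring.
specialize (H H1 H2).
exists (a + t * (b - a)). split.
- unfold unit_I in *. nra.
- destruct (k t) as [k1 k2]. simpl in *. subst. f_equal. ring.
Qed.

(** The hypothesis says that the common starting point is a projection of every point of the first
    lift onto the second. (A) then is the conclusion; (NE) yields it because a point of the second
    lift is its own projection. *)
Lemma l2_prod_perp_symm (M : Type) (d : M -> M -> R) (g h : R -> M) (u v : R) :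
  is_metric d -> geodesic_space d -> busemann_convex d ->
  prop_SO (l2_prod_dist d) \/ prop_A (l2_prod_dist d) \/ prop_NE (l2_prod_dist d) ->
  is_geodesic d g -> is_geodesic d h -> g 0 = h 0 ->
  perp (l2_prod_dist d) (g 0, 0) (fun t => (g t, u * t)) (fun t => (h t, v * t)) ->
  perp (l2_prod_dist d) (g 0, 0) (fun t => (h t, v * t)) (fun t => (g t, u * t)).
Proof.
intros Hd Hgs Hb HP Hg Hh H0 Hperp.
pose proof (l2_prod_metric Hd) as HX. pose proof HX as (_ & _ & Hsym & _).
set (G := fun t => (g t, u * t)) in *. set (H := fun t => (h t, v * t)) in *.
assert (HG : is_geodesic (l2_prod_dist d) G) by now apply l2_prod_geodesic.
assert (HH : is_geodesic (l2_prod_dist d) H) by now apply l2_prod_geodesic.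
assert (G0 : G 0 = (g 0, 0)) by (unfold G; now rewrite Rmult_0_r).
assert (HE : H 0 = (g 0, 0)) by (unfold H; now rewrite Rmult_0_r, H0).
assert (Hproj : forall t, unit_I t ->
          proj (l2_prod_dist d) (geodesic_image H) (G t) (g 0, 0)).
{ intros t Ht. split.
  - exists 0. split; [unfold unit_I; lra|congruence].
  - intros c [s [Hs ->]]. rewrite (Hsym (G t)), (Hsym (G t)). now apply Hperp. }
destruct HP as [HSO|[HA|HNE]].
- pose proof (HSO G H HG HH ltac:(congruence)) as E. rewrite G0 in E. now apply E.
- intros s t Hs Ht. apply (HA H (G s) HH t); auto.
- intros s t Hs Ht.
  apply (HNE (geodesic_image H)) ; auto.
  + now apply geodesic_image_closed.
  + now apply l2_prod_geodesic_image_convex.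
  + split; [now exists t|]. intros c _. rewrite (dist_refl _ HX). apply sqrt_pos.
Qed.

(** * First variation of the distance *)

(** Cancel [q ^ 2], divide by [2 * l] and let [l] tend to 0. The proof picks one [l] so small that
    the quadratic terms cannot make up for [k - q * w]. *)
Lemma slope_ge_of_sqr_ge (q w k C l0 : R) :
  0 < l0 ->
  (forall l, 0 < l <= l0 -> q ^ 2 + 2 * l * k - l ^ 2 * C <= (q + l * w) ^ 2) ->
  k <= q * w.
Proof.
intros Hl0 H. apply Rnot_lt_le. intros Hlt.
set (K := w ^ 2 + Rabs C + 1).
assert (HK : 0 < K) by (unfold K; pose proof (Rabs_pos C); nra).
assert (HC : w ^ 2 + C < K) by (unfold K; pose proof (Rle_abs C); lra).
set (l := Rmin l0 ((k - q * w) / K)).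
assert (Hl : 0 < l).
{ unfold l. apply Rmin_glb_lt; [assumption|]. apply Rdiv_lt_0_compat; lra. }
assert (HlK : l * K <= k - q * w).
{ replace (k - q * w) with ((k - q * w) / K * K) by (field; lra).
  apply Rmult_le_compat_r; [lra|apply Rmin_r]. }
specialize (H l (conj Hl (Rmin_l _ _))). nra.
Qed.

(** In Euclidean terms [k] is minus the inner product of the initial velocities
    of [g] and [h]. The vertical speeds [a] and [k / a] are chosen so that the
    hypothesis makes the two lifts orthogonal in [M x R]. *)
Lemma first_variation_symm (M : Type) (d : M -> M -> R) (g h : R -> M) (k : R) :
  is_metric d -> geodesic_space d -> busemann_convex d ->
  prop_SO (l2_prod_dist d) \/ prop_A (l2_prod_dist d) \/ prop_NE (l2_prod_dist d) ->
  is_geodesic d g -> is_geodesic d h -> g 0 = h 0 ->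
  let a := d (g 0) (g 1) in let b := d (h 0) (h 1) in 0 < a ->
  (forall s, unit_I s -> a ^ 2 + k * s <= a * d (g 1) (h s)) ->
  forall r, unit_I r -> b ^ 2 + k * r <= b * d (g r) (h 1).
Proof.
intros Hd Hgs Hb HP Hg Hh H0 a b Ha Hk r Hr.
pose proof Hd as (Hpos & Hsep & Hsym & Htri).
set (v := k / a). assert (Hv : a * v = k) by (unfold v; field; lra).
(* The bound at [g 1] passes to [g t] by the triangle inequality, since the remaining piece of [g]
   has length [(1 - t) * a]. *)
assert (Hk' : forall t s, unit_I t -> unit_I s -> a * t + v * s <= d (g t) (h s)).
{ intros t s Ht Hs. pose proof (Hk s Hs) as H1. pose proof (geodesic_end Hg Ht) as H2.
  pose proof (Htri (g 1) (g t) (h s)) as H3. rewrite (Hsym (g 1) (g t)), H2 in H3. fold a in H3.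
  apply Rmult_le_reg_l with a; [assumption|].
  assert (a * d (g 1) (h s) <= a * ((1 - t) * a + d (g t) (h s)))
    by (apply Rmult_le_compat_l; lra).
  nra. }
assert (Hperp : perp (l2_prod_dist d) (g 0, 0) (fun t => (g t, a * t)) (fun t => (h t, v * t))).
{ intros s t Hs Ht. unfold l2_prod_dist; simpl fst; simpl snd. apply sqrt_le_1_alt.
  rewrite (geodesic_start Hg Ht), (Hsym (h s)). fold a.
  pose proof (Hk' t s Ht Hs) as H1. pose proof (Hpos (g t) (h s)) as H2.
  assert (H3 : 0 <= a * t) by (unfold unit_I in Ht; nra).
  set (A := a * t) in *. set (V := v * s) in *.
  replace (t * a) with A by (unfold A; ring).
  (* If [A + V] is nonnegative, use [(A + V) ^ 2 + (V - A) ^ 2 = 2 * A ^ 2 + 2 * V ^ 2]; otherwise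
     the vertical gap alone exceeds [2 * A]. *)
  destruct (Rle_dec 0 (A + V)); nra. }
apply (l2_prod_perp_symm Hd Hgs Hb HP Hg Hh H0) in Hperp.
enough (k * r <= b * (d (g r) (h 1) - b)) by lra.
(* Evaluate the reversed orthogonality at [h 1] and [g (l * r)] for small [l]. The error
   [a ^ 2 * r ^ 2] comes from the squared height of the lift of [g (l * r)], and convexity bounds
   the distance linearly in [l]. *)
apply (@slope_ge_of_sqr_ge b _ _ (a ^ 2 * r ^ 2) 1); [lra|].
intros l Hl.
assert (Hlr : unit_I (l * r)) by (unfold unit_I in *; nra).
assert (I1 : unit_I 1) by (unfold unit_I; lra).
pose proof (Hperp (l * r) 1 Hlr I1) as H.
assert (H' : b ^ 2 + v ^ 2 <= d (g (l * r)) (h 1) ^ 2 + (a * (l * r) - v) ^ 2).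
{ pose proof (l2_prod_sqr d (g 0, 0) (h 1, v * 1)) as E1.
  pose proof (l2_prod_sqr d (g (l * r), a * (l * r)) (h 1, v * 1)) as E2.
  simpl fst in *; simpl snd in *. rewrite H0 in E1. fold b in E1. rewrite H0 in H.
  pose proof (proj1 (l2_prod_metric Hd) (h 0, 0) (h 1, v * 1)). nra. }
assert (Hc : d (g (l * r)) (h 1) <= b + l * (d (g r) (h 1) - b)).
{ assert (I0 : unit_I 0) by (unfold unit_I; lra).
  pose proof (busemann_point (h 1) Hd Hgs Hb (geodesic_sub Hg I0 Hr) (t := l)
    ltac:(unfold unit_I; lra)) as H1. cbv beta in H1.
  replace (0 + l * (r - 0)) with (l * r) in H1 by ring.
  replace (0 + 0 * (r - 0)) with 0 in H1 by ring.
  replace (0 + 1 * (r - 0)) with r in H1 by ring.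
  rewrite !(Hsym (h 1)), H0 in H1. fold b in H1. lra. }
pose proof (Hpos (g (l * r)) (h 1)).
assert (d (g (l * r)) (h 1) ^ 2 <= (b + l * (d (g r) (h 1) - b)) ^ 2) by nra.
rewrite <- Hv. nra.
Qed.

(** Here [- kR] and [- kQ] play the roles of [a] and [b] times the left derivatives of
    [f ^ 2 / 2] at [a] and [b]. *)
Lemma first_variation_gap (M : Type) (d : M -> M -> R) (gam : R -> M) (x : M)
  (a b kR kQ : R) :
  is_metric d -> geodesic_space d -> busemann_convex d ->
  prop_SO (l2_prod_dist d) \/ prop_A (l2_prod_dist d) \/ prop_NE (l2_prod_dist d) ->
  is_geodesic d gam ->
  let l := d (gam 0) (gam 1) in let f := fun t => d x (gam t) in
  0 < l -> 0 < a < b -> b <= 1 -> 0 < f a -> 0 < f b ->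
  (forall s, unit_I s -> f b ^ 2 + kQ * s <= f b * f (b * (1 - s))) ->
  (exists s, unit_I s /\ f a * f (a * (1 - s)) < f a ^ 2 + kR * s) ->
  kQ * a < kR * b - (b - a) * l ^ 2 * a * b.
Proof.
intros Hd Hgs Hb HP Hgam l f Hl Hab Hb1 Hfa Hfb HQ [s0 [Hs0 HR]].
pose proof Hd as (Hpos & Hsep & Hsym & Htri).
assert (I0 : unit_I 0) by (unfold unit_I; lra).
assert (Ia : unit_I a) by (unfold unit_I; lra).
assert (Ib : unit_I b) by (unfold unit_I; lra).
destruct (Hgs (gam a) x) as [sR [HsR [sR0 sR1]]].
destruct (Hgs (gam b) x) as [sQ [HsQ [sQ0 sQ1]]].
pose proof (geodesic_sub Hgam Ia I0) as HhR.
pose proof (geodesic_sub Hgam Ib I0) as HhQ.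
assert (E0 : forall c, gam (c + 0 * (0 - c)) = gam c) by (intros; f_equal; ring).
assert (E1 : forall c, gam (c + 1 * (0 - c)) = gam 0) by (intros; f_equal; ring).
assert (Es : forall c s, gam (c + s * (0 - c)) = gam (c * (1 - s))) by (intros; f_equal; ring).
assert (La : d (gam a) (gam 0) = a * l).
{ rewrite Hsym. now apply geodesic_start. }
assert (Lb : d (gam b) (gam 0) = b * l).
{ rewrite Hsym. now apply geodesic_start. }
(* At [gam b] the slope bound for the distance to [x] along [gam] becomes one for the distance to
   [gam 0] along the geodesic to [x]. *)
pose proof (first_variation_symm (k := kQ) Hd Hgs Hb HP HsQ HhQ) as VQ. cbv beta zeta in VQ.
rewrite E0, E1, sQ0, sQ1, Lb, (Hsym _ x) in VQ.
specialize (VQ eq_refl Hfb).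
assert (VQ' : forall r, unit_I r -> (b * l) ^ 2 + kQ * r <= b * l * d (sQ r) (gam 0)).
{ apply VQ. intros s Hs. rewrite Es. now apply HQ. }
clear VQ.
(* At [gam a] the symmetry is used contrapositively, with the two geodesics exchanged: a bound for
   all [e] would contradict [HR]. *)
assert (VR : exists e, unit_I e /\ a * l * d (gam 0) (sR e) < (a * l) ^ 2 + kR * e).
{ apply NNPP. intros HN.
  pose proof (first_variation_symm (k := kR) Hd Hgs Hb HP HhR HsR) as VR. cbv beta zeta in VR.
  rewrite E0, E1, sR0, sR1, La, (Hsym _ x) in VR.
  specialize (VR eq_refl ltac:(nra)).
  assert (V : forall e, unit_I e -> (a * l) ^ 2 + kR * e <= a * l * d (gam 0) (sR e)).
  { intros e He. apply Rnot_lt_le. intros Hlt. apply HN. now exists e. }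
  pose proof (VR V s0 Hs0) as V0. rewrite Es, (Hsym _ x) in V0. unfold f in HR. lra. }
destruct VR as [e [He VR]]. specialize (VQ' e He).
assert (Hcone : d (sR e) (sQ e) <= (1 - e) * ((b - a) * l)).
{ pose proof (geodesic_rev HsR) as RR. pose proof (geodesic_rev HsQ) as RQ.
  assert (E : (1 - 0 = 1) /\ (1 - 1 = 0)) by (split; ring). destruct E as [E10 E11].
  pose proof (@busemann_cone M d _ _ (1 - e) Hd Hgs Hb RR RQ) as C. cbv beta in C.
  rewrite E10, E11, sR0, sR1, sQ0, sQ1 in C.
  replace (1 - (1 - e)) with e in C by ring.
  rewrite Hgam, (Rabs_left1 (a - b)) in C by (assumption || lra). fold l in C.
  replace (- (a - b)) with (b - a) in C by ring.
  apply C; [reflexivity|unfold unit_I in *; lra]. }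
pose proof (Htri (gam 0) (sR e) (sQ e)) as T. rewrite (Hsym (sQ e)) in VQ'.
assert (e <> 0).
{ intros ->. rewrite sR0, (Hsym (gam 0)), La in VR. nra. }
unfold unit_I in He.
set (X := d (gam 0) (sR e)) in *. set (Y := d (gam 0) (sQ e)) in *.
(* Scaling by [a] and [b] makes the zeroth-order terms cancel, as
   [a * b ^ 2 - a ^ 2 * b = a * b * (b - a)]; what is left is divisible by [e]. *)
assert (H1 : a * ((b * l) ^ 2 + kQ * e) <= a * (b * l * Y)) by (apply Rmult_le_compat_l; lra).
assert (H2 : b * (a * l * X) < b * ((a * l) ^ 2 + kR * e)) by (apply Rmult_lt_compat_l; lra).
assert (H3 : a * b * l * Y <= a * b * l * (X + (1 - e) * ((b - a) * l))).
{ apply Rmult_le_compat_l; [|lra]. repeat apply Rmult_le_pos; lra. }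
apply Rmult_lt_reg_r with e; [lra|]. nra.
Qed.

(** * The midpoint inequality and CAT(0) *)

Lemma sqr_dist_midpoint_le (M : Type) (d : M -> M -> R) (gam : R -> M) (x : M) :
  is_metric d -> geodesic_space d -> busemann_convex d ->
  prop_SO (l2_prod_dist d) \/ prop_A (l2_prod_dist d) \/ prop_NE (l2_prod_dist d) ->
  is_geodesic d gam ->
  d x (gam (1/2)) ^ 2 <=
    (d x (gam 0) ^ 2 + d x (gam 1) ^ 2) / 2 - d (gam 0) (gam 1) ^ 2 / 4.
Proof.
intros Hd Hgs Hb HP Hgam. pose proof Hd as (Hpos & Hsep & Hsym & Htri).
assert (I0 : unit_I 0) by (unfold unit_I; lra).
assert (I1 : unit_I 1) by (unfold unit_I; lra).
assert (I2 : unit_I (1/2)) by (unfold unit_I; lra).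
set (l := d (gam 0) (gam 1)). set (f := fun t => d x (gam t)).
assert (Hlpos : 0 <= l) by apply Hpos.
assert (Hfpos : forall t, 0 <= f t) by (intros; apply Hpos).
change (f (1/2) ^ 2 <= (f 0 ^ 2 + f 1 ^ 2) / 2 - l ^ 2 / 4).
(* When [x] lies on [gam], equality holds by direct computation. Otherwise [f] is positive, as the
   first variation requires. *)
destruct (classic (exists t, unit_I t /\ f t = 0)) as [[t [Ht H0]]|Hoff].
{ apply Hsep in H0. unfold f. rewrite H0, (Hgam t (1/2)), (Hgam t 0), (Hgam t 1) by assumption. fold l.
  rewrite !Rpow_mult_distr, !pow2_abs. lra. }
assert (Hf : forall t, unit_I t -> 0 < f t).
{ intros t Ht. destruct (Rle_lt_or_eq_dec _ _ (Hfpos t)) as [|E]; [assumption|].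
  exfalso. apply Hoff. now exists t. }
assert (HLip : forall s t, unit_I s -> unit_I t -> Rabs (f s - f t) <= l * Rabs (s - t)).
{ intros s t Hs Ht. pose proof (dist_diff_le x (gam s) x (gam t) Hd) as H.
  rewrite (dist_refl _ Hd), Hgam in H by assumption. fold l in H. unfold f. lra. }
destruct (Req_dec l 0) as [El|El].
{ pose proof (HLip (1/2) 0 I2 I0) as HA. pose proof (HLip (1/2) 1 I2 I1) as HB.
  rewrite El, Rmult_0_l in HA, HB.
  apply Rabs_le_bounds in HA. apply Rabs_le_bounds in HB.
  replace (f 0) with (f (1/2)) by lra. replace (f 1) with (f (1/2)) by lra.
  rewrite El. lra. }
assert (Hl : 0 < l) by lra.
apply Rnot_lt_le. intros Hbad.
(* Subtracting this linear term gives [F] equal values at 0 and 1, and [Hbad] says exactly that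
   [F (1/2)] exceeds them. *)
set (mu := f 1 ^ 2 - f 0 ^ 2 - l ^ 2).
set (F := fun t => f t ^ 2 - l ^ 2 * t ^ 2 - mu * t).
assert (HFLip : exists K, forall s t, unit_I s -> unit_I t ->
          Rabs (F s - F t) <= K * Rabs (s - t)).
{ exists (2 * (f 0 + l) * l + 2 * l ^ 2 + Rabs mu). intros s t Hs Ht.
  pose proof (HLip s t Hs Ht) as HA.
  pose proof (HLip s 0 Hs I0) as HB. pose proof (HLip t 0 Ht I0) as HC.
  unfold unit_I in Hs, Ht.
  rewrite Rminus_0_r, (Rabs_right s) in HB by lra.
  rewrite Rminus_0_r, (Rabs_right t) in HC by lra.
  apply Rabs_le_bounds in HB. apply Rabs_le_bounds in HC.
  replace (F s - F t) with ((f s - f t) * (f s + f t) + - (l ^ 2 * (s + t) * (s - t))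
    + - (mu * (s - t))) by (unfold F; ring).
  eapply Rle_trans; [apply Rabs_triang|]. rewrite Rabs_Ropp, Rabs_mult.
  eapply Rle_trans; [apply Rplus_le_compat_r, Rabs_triang|].
  rewrite Rabs_Ropp, !Rabs_mult.
  pose proof (Hfpos s). pose proof (Hfpos t).
  rewrite (Rabs_right (f s + f t)), (Rabs_right (l ^ 2)), (Rabs_right (s + t)) by nra.
  assert (f s + f t <= 2 * (f 0 + l)) by nra.
  pose proof (Rabs_pos (s - t)). pose proof (Rabs_pos (f s - f t)).
  assert (Rabs (f s - f t) * (f s + f t) <= l * Rabs (s - t) * (2 * (f 0 + l)))
    by (apply Rmult_le_compat; lra).
  assert (l ^ 2 * (s + t) * Rabs (s - t) <= l ^ 2 * 2 * Rabs (s - t)).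
  { apply Rmult_le_compat_r; [assumption|]. apply Rmult_le_compat_l; [nra|lra]. }
  lra. }
destruct HFLip as [K HK].
(* If [F (1/2)] exceeded the common end value of [F], [F] would decrease from its
   maximum at [a] to [1], so some left slope of [F] after [a] would be negative, while that at
   [a] is not. *)
destruct (@lipschitz_attains_min (fun t => - F t) 0 1 K) as [a [Ha Hamax]]; [lra| |].
{ intros s t Hs Ht. replace (- F s - - F t) with (- (F s - F t)) by ring.
  rewrite Rabs_Ropp. now apply HK. }
assert (F0 : F 0 = f 0 ^ 2) by (unfold F; ring).
assert (F1 : F 1 = f 0 ^ 2) by (unfold F, mu; ring).
assert (Fa : f 0 ^ 2 < F a).
{ pose proof (Hamax (1/2) ltac:(lra)) as H. unfold F in H at 2. unfold mu in H. lra. }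
assert (a <> 0) by (intros ->; lra). assert (a <> 1) by (intros ->; lra).
set (kap := F a - f 0 ^ 2).
(* The tilted function takes the value [F a] at 1 and the larger value [F a + kap * a] at [a], so
   its minimum [b] lies beyond [a]; minimality there bounds the left slopes of [F] by [- kap]. *)
destruct (@lipschitz_attains_min (fun t => F t + kap * t) a 1 (K + kap)) as [b [Hb1 Hbmin]];
  [lra| |].
{ intros s t Hs Ht.
  replace (F s + kap * s - (F t + kap * t)) with (F s - F t + kap * (s - t)) by ring.
  eapply Rle_trans; [apply Rabs_triang|].
  rewrite Rabs_mult, (Rabs_right kap) by (unfold kap; lra).
  pose proof (HK s t ltac:(unfold unit_I; lra) ltac:(unfold unit_I; lra)). lra. }
assert (Hba : b <> a).
{ intros ->. pose proof (Hbmin 1 ltac:(lra)) as H1. rewrite F1 in H1. unfold kap in H1. nra. }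
assert (Hkap : 0 < kap) by (unfold kap; lra).
(* Both constants correspond to the slope [- kap] of [F], at [a] and at [b]. They satisfy the gap
   relation with equality, which contradicts its strict form. *)
set (kR := kap * a / 2 - l ^ 2 * a ^ 2 - mu * a / 2).
set (kQ := kap * b / 2 - l ^ 2 * b ^ 2 - mu * b / 2).
enough (Hgap : kQ * a < kR * b - (b - a) * l ^ 2 * a * b)
  by (unfold kQ, kR in Hgap; lra).
apply (@first_variation_gap M d gam x a b kR kQ Hd Hgs Hb HP Hgam); fold l; try lra.
- apply Hf. unfold unit_I. lra.
- apply Hf. unfold unit_I. lra.
- fold (f b). intros s Hs. change (d x (gam (b * (1 - s)))) with (f (b * (1 - s))).
  enough (kQ * s <= f b * (f (b * (1 - s)) - f b)) by lra.
  (* The range [(b - a) / b] keeps [b * (1 - e * s)] inside [[a, b]]. The quadratic remainder is the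
     square of [l * b * (e * s)], with the favourable sign, so the error constant is 0. *)
  apply (@slope_ge_of_sqr_ge (f b) _ _ 0 ((b - a) / b)).
  { apply Rdiv_lt_0_compat; lra. }
  intros e He. unfold unit_I in Hs.
  assert (Heb : e * b <= b - a).
  { replace (b - a) with ((b - a) / b * b) by (field; lra). apply Rmult_le_compat_r; lra. }
  assert (e <= 1) by nra.
  assert (Hes : 0 <= e * s <= e) by nra.
  pose proof (Hbmin (b * (1 - e * s)) ltac:(nra)) as HF.
  assert (Hc : f (b * (1 - e * s)) <= f b + e * (f (b * (1 - s)) - f b)).
  { assert (Ib : unit_I b) by (unfold unit_I; lra).
    assert (Is : unit_I (b * (1 - s))) by (unfold unit_I; nra).
    pose proof (busemann_point x Hd Hgs Hb (geodesic_sub Hgam Ib Is) (t := e)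
      ltac:(unfold unit_I; lra)) as C. cbv beta in C.
    replace (b + e * (b * (1 - s) - b)) with (b * (1 - e * s)) in C by ring.
    replace (b + 0 * (b * (1 - s) - b)) with b in C by ring.
    replace (b + 1 * (b * (1 - s) - b)) with (b * (1 - s)) in C by ring.
    unfold f. lra. }
  pose proof (Hfpos (b * (1 - e * s))).
  assert (f (b * (1 - e * s)) ^ 2 <= (f b + e * (f (b * (1 - s)) - f b)) ^ 2)
    by (apply pow_incr; lra).
  unfold F in HF. unfold kQ.
  pose proof (pow2_ge_0 (l * b * (e * s))). nra.
(* Maximality at [a] and the inequality between arithmetic and geometric means reduce the goal to
   [s * l ^ 2 * a < kap], which this [s] satisfies while staying at most 1. *)
- set (s := kap / (l ^ 2 * a + kap)).
  assert (Hden : 0 < l ^ 2 * a) by (apply Rmult_lt_0_compat; nra).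
  assert (Hs : 0 < s) by (apply Rdiv_lt_0_compat; lra).
  assert (Hss : s * (l ^ 2 * a + kap) = kap) by (unfold s; field; lra).
  assert (s <= 1) by nra.
  exists s. split; [unfold unit_I; lra|].
  change (f a * f (a * (1 - s)) < f a ^ 2 + kR * s).
  pose proof (Hamax (a * (1 - s)) ltac:(nra)) as HF. unfold F in HF.
  pose proof (pow2_ge_0 (f a - f (a * (1 - s)))) as Hamgm.
  assert (Hsmall : l ^ 2 * a ^ 2 * s ^ 2 < kap * a * s).
  { replace (l ^ 2 * a ^ 2 * s ^ 2) with (s * (l ^ 2 * a) * (a * s)) by ring.
    replace (kap * a * s) with (kap * (a * s)) by ring.
    apply Rmult_lt_compat_r; nra. }
  unfold kR. nra.
Qed.

Theorem theorem2 (M : Type) (d : M -> M -> R) :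
  is_metric d -> complete d -> geodesic_space d -> busemann_convex d ->
  (forall (lam : nat -> R) (U : (nat -> Prop) -> Prop),
      (forall n, 0 < lam n) -> Un_cv lam 0 -> nonprincipal_ultrafilter U ->
      forall x : M,
        pgeodesic_space (tangent_dist d lam U x) /\
        pbusemann_convex (tangent_dist d lam U x)) ->
  (prop_SO (l2_prod_dist d) \/ prop_A (l2_prod_dist d) \/ prop_NE (l2_prod_dist d)) ->
  CAT0 d.
Proof.
intros Hd _ Hgs Hb _ HP x y z m [x1 x2] [y1 y2] [z1 z2] Hxy Hyz Hxz [Hym Hmz].
destruct (@geodesic_through M d y m z (1/2) Hd Hgs ltac:(lra) ltac:(lra) ltac:(lra))
  as [gam [Hgam [<- [<- <-]]]].
(* In the plane the same midpoint relation is an equality, the median formula, so the inequality in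
   M becomes the comparison. *)
pose proof (sqr_dist_midpoint_le x Hd Hgs Hb HP Hgam) as HCN.
rewrite <- Hxy, <- Hyz, <- Hxz in HCN. unfold eucl in *; simpl fst in *; simpl snd in *.
assert (Hs : forall u v, 0 <= u ^ 2 + v ^ 2).
{ intros. apply Rplus_le_le_0_compat; apply pow2_ge_0. }
rewrite !pow2_sqrt in HCN by apply Hs.
rewrite <- (sqrt_pow2 (d x _)) by apply Hd. apply sqrt_le_1_alt. lra.
Qed.
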